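(* There is an absolute constant $C>0$ such that the following holds. Let $\mathcal{F}$ be any finite subset of $\mathbb{Z}^m$, let $P=\mathrm{conv}(\mathcal{F})$, and let $M$ be the unary facet complexity of $P$. Then for every function $p:\mathcal{F}\to\mathbb{R}_{>0}$ and every $\varepsilon>0$, with $$R = C\, m^{3/2}\, M\,\Big(L_p+\log|\mathcal{F}|+\log\tfrac{m}{\varepsilon}\Big),$$ it holds that for every $\theta\in P$ there exists $y\in B(0,R)$ with $h_\theta(y)\le g(\theta)+\varepsilon$.
   Context: For a finite $\mathcal{F}\subseteq\mathbb{Z}^m$ and $p:\mathcal{F}\to\mathbb{R}_{>0}$ (write $p_\alpha=p(\alpha)$), define for $\theta,y\in\mathbb{R}^m$: $h_\theta(y)=\log\big(\sum_{\alpha\in\mathcal{F}}p_\alpha e^{\langle \alpha-\theta,y\rangle}\big)$ and $g(\theta)=\inf_{y\in\mathbb{R}^m}h_\theta(y)$. The bit complexity of $p$ is $L_p=\max_{\alpha\in\mathcal{F}}|\log p_\alpha|$. $B(0,R)$ is the closed Euclidean ball of radius $R$ centered at the origin. Unary facet complexity: for a polytope $P\subseteq\mathbb{R}^m$ with integer vertices, $\mathrm{fc}(P)$ is the smallest $M\in\mathbb{N}$ such that $P=\{x\in\mathbb{R}^m:\langle a_i,x\rangle\le b_i \text{ for } i\in I\}\cap H$ for some finite index set $I$, vectors $a_i\in\mathbb{Z}^m$ with $\|a_i\|_\infty\le M$, reals $b_i$, and a linear subspace $H$ of $\mathbb{R}^m$.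
   Formalization: The ball B(0,R) is taken with radius max(0,R) instead of R, since for large ε the number R is negative (e.g. m=1, F={0,1}, p=1, ε=3) and the ball would be empty; for R≥0 the statement is unchanged. *)

(* Defs.v *)
From HB Require Import structures.
From mathcomp Require Import all_boot all_order all_algebra.
From mathcomp Require Import finmap.
From mathcomp Require Import all_classical all_reals all_analysis.

Set Implicit Arguments.
Unset Strict Implicit.
Unset Printing Implicit Defensive.

Import Order.TTheory GRing.Theory Num.Theory.

Local Open Scope classical_set_scope.
Local Open Scope ring_scope.

Section MaxEntropyDual.
Context {R : realType} {m : nat}.
Implicit Types (F : {fset 'rV[int]_m}) (x y theta : 'rV[R]_m).

Definition dot x y : R := \sum_(i < m) x 0 i * y 0 i.

(* The norm that the library puts on 'rV[R]_m is the max norm. *)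
Definition norm2 x : R := Num.sqrt (dot x x).

Definition realvec (a : 'rV[int]_m) : 'rV[R]_m := map_mx intr a.

Definition conv_hull F : set 'rV[R]_m :=
  [set x | exists w : F -> R,
     [/\ forall a, 0 <= w a, \sum_(a : F) w a = 1
       & x = \sum_(a : F) w a *: realvec (val a)]].

Definition hfun F (p : F -> R) theta y : R :=
  ln (\sum_(a : F) p a * expR (dot (realvec (val a) - theta) y)).

(* The infimum is taken in \bar R: for nonempty F it is -oo as soon as theta is
   not in conv_hull F. *)
Definition gfun F (p : F -> R) theta : \bar R :=
  ereal_inf (range (fun y => (hfun p theta y)%:E)).

(* The terms are nonnegative, so for nonempty F this is the plain maximum. *)
Definition bit_complexity F (p : F -> R) : R :=
  \big[Num.max/0]_(a : F) `|ln (p a)|.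

Definition facet_bounded (P : set 'rV[R]_m) (M : nat) : Prop :=
  exists (k : nat) (a : 'I_k -> 'rV[int]_m) (b : 'I_k -> R)
         (H : {vspace 'rV[R]_m}),
    (forall i j, `|a i 0 j| <= M%:Z) /\
    P = [set x | forall i, dot (realvec (a i)) x <= b i] `&` [set` H].

(* M = fc(P). A least M exists whenever P is the convex hull of finitely many
   integer points. *)
Definition is_unary_facet_complexity (P : set 'rV[R]_m) (M : nat) : Prop :=
  facet_bounded P M /\ forall M', facet_bounded P M' -> (M <= M')%N.

End MaxEntropyDual.

(* Main.v *)
(* Fix any y, let a0 be a point of F maximizing <., y>, and write P as
   {x in H | <a_i, x> <= b_i}. By Farkas' lemma relative to H, together with
   Caratheodory's theorem, y agrees on H with a combination sum_i beta_i a_i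
   with beta_i >= 0, at most m of them nonzero, and only constraints tight at a0
   involved. Replacing each beta_i by min(beta_i, D) gives a vector y' of norm at
   most m^(3/2) M D. This does not increase <a0 - theta, y>, because
   <a_i, a0 - theta> >= 0; and for a in F the integer <a_i, a0 - a> is either 0,
   so the truncation of beta_i has no effect, or at least 1, so the term of a
   is at most p_a exp(-D) relative to the exponent of a0. Hence
   h(y') <= h(y) + |F| exp(2 L_p - D), and it remains to start from an
   (eps/2)-minimizer y. If |F| = 1 then h is constant, and if
   eps >= 2 L_p + log |F| then y = 0 already works; excluding these two cases
   lets C absorb the factor 2 in log (2 / eps) even if m = 1. *)

Require Import Defs.
From HB Require Import structures.
From mathcomp Require Import all_boot all_order all_algebra.
From mathcomp Require Import finmap.
From mathcomp Require Import all_classical all_reals all_analysis.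
From mathcomp Require Import ring lra.

Set Implicit Arguments.
Unset Strict Implicit.
Unset Printing Implicit Defensive.

Import Order.TTheory GRing.Theory Num.Theory.

Local Open Scope classical_set_scope.
Local Open Scope ring_scope.

(* Farkas' lemma relative to V. The induction on n eliminates f 0 by passing to
   the hyperplane V `&` ker (f 0); as this lowers the dimension exactly when a
   new generator is used, it also yields Caratheodory's bound. *)
Lemma farkas_caratheodory (K : realFieldType) (vT : vectType K) (n : nat)
    (f : 'I_n -> 'Hom(vT, K^o)) (g : 'Hom(vT, K^o)) (V : {vspace vT}) :
  (exists beta : 'I_n -> K,
     [/\ forall i, 0 <= beta i, (#|[pred i | beta i != 0%R]| <= \dim V)%N
       & {in V, forall x, g x = \sum_(i < n) beta i * f i x}]) \/
  (exists z, [/\ z \in V, forall i, f i z <= 0 & 0 < g z]).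
Proof.
elim: n f V => [|n IH] f V.
  have [[x [xV gx0]]|nex] := pselect (exists x, x \in V /\ g x != 0).
    right; move: gx0; rewrite neq_lt => /orP[gx|gx]; last first.
      by exists x; split => // -[].
    exists (- x); rewrite rpredN linearN /= oppr_gt0.
    by split => // -[].
  left; exists (fun=> 0); split => //.
    by rewrite eq_card0// => -[].
  move=> x xV; rewrite big_ord0; apply/eqP/negP => /negP gx0.
  by apply: nex; exists x.
(* The coefficient [c] of [f ord0] is put in front of [beta]; the support grows by one only if [c]
   is nonzero. *)
have extend (W : {vspace vT}) (beta : 'I_n -> K) (c : K) :
    (forall i, 0 <= beta i) -> (#|[pred i | beta i != 0%R]| <= \dim W)%N ->
    0 <= c -> (\dim W + (c != 0%R) <= \dim V)%N ->
    {in V, forall x, g x = c * f ord0 x +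
                       \sum_(i < n) beta i * f (lift ord0 i) x} ->
    exists beta' : 'I_n.+1 -> K,
     [/\ forall i, 0 <= beta' i, (#|[pred i | beta' i != 0%R]| <= \dim V)%N
       & {in V, forall x, g x = \sum_(i < n.+1) beta' i * f i x}].
  move=> beta0 card_beta c0 dimW gE.
  exists (fun i => if unlift ord0 i is Some j then beta j else c); split.
  - by move=> i; case: unliftP.
  - apply: leq_trans dimW; rewrite -sum1_card big_mkcond big_ord_recl /= inE.
    rewrite unlift_none addnC leq_add//.
    rewrite (leq_trans _ card_beta)// -sum1_card [leqRHS]big_mkcond /=.
    by apply: leq_sum => i _; rewrite !inE liftK.
  - move=> x xV; rewrite gE// big_ord_recl unlift_none; congr (_ + _).
    by apply: eq_bigr => i _; rewrite liftK.
have [[beta [beta0 card_beta gE]]|[z [zV fz gz]]] :=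
    IH (fun i => f (lift ord0 i)) V.
  left; apply: (extend V beta 0) => //; first by rewrite eqxx addn0.
  by move=> x xV; rewrite mul0r add0r gE.
have [f0z|f0z] := leP (f ord0 z) 0.
  right; exists z; split => // i.
  by case: (unliftP ord0 i) => [j ->|->].
(* [z] lies in [V] but not in the kernel of [f ord0], so the dimension drops and leaves room for one
   more generator. *)
have dimW : (\dim (V :&: lker (f ord0)) < \dim V)%N.
  rewrite ltn_neqAle dimvS ?capvSl// andbT.
  apply/negP => /eqP dimE.
  have /eqP VE : (V :&: lker (f ord0) == V)%VS.
    by rewrite eqEdim capvSl dimE leqnn.
  by move: zV; rewrite -VE memv_cap memv_ker (gt_eqF f0z) andbF.
have [[beta [beta0 card_beta gE]]|[w [wW fw gw]]] :=
    IH (fun i => f (lift ord0 i)) (V :&: lker (f ord0))%VS; last first.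
  right; exists w; move: wW; rewrite memv_cap memv_ker => /andP[wV /eqP f0w].
  split => // i.
  by case: (unliftP ord0 i) => [j ->//|->]; rewrite f0w.
pose S x := \sum_(i < n) beta i * f (lift ord0 i) x.
have Sz : S z <= 0 by apply: sumr_le0 => i _; rewrite mulr_ge0_le0.
(* The required identity at [z] forces this value; it is positive because [S z <= 0 < g z]. *)
pose c : K := (g z - S z) / f ord0 z.
have c0 : 0 < c by rewrite divr_gt0// subr_gt0 (le_lt_trans Sz).
left; apply: (extend (V :&: lker (f ord0))%VS beta c) => //.
- exact: ltW.
- by rewrite (gt_eqF c0) addn1.
move=> x xV.
(* [x - t z] is the projection of [x] onto [ker (f 0)] along [z]. *)
pose t : K := f ord0 x / f ord0 z.
have xW : x - t *: z \in (V :&: lker (f ord0))%VS.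
  rewrite memv_cap rpredB ?rpredZ//= memv_ker linearB linearZ /=.
  have f0z_neq0 : f ord0 z != 0 by rewrite gt_eqF.
  rewrite /t /GRing.scale /= divfK ?f0z_neq0 //.
  by apply/eqP; exact: (@subrr K).
have Slin : S (x - t *: z) = S x - t * S z.
  rewrite /S mulr_sumr -sumrB; apply: eq_bigr => i _.
  by rewrite linearB linearZ /= /GRing.scale /=; ring.
have := gE _ xW; rewrite -/(S _) Slin linearB linearZ /= /GRing.scale /=.
move=> /eqP; rewrite subr_eq => /eqP ->; rewrite -/(S x) /c /t.
by field; rewrite gt_eqF.
Qed.

(** * Inner product and Euclidean norm *)

Lemma dotC (R : realType) m (x y : 'rV[R]_m) : dot x y = dot y x.
Proof. by apply: eq_bigr => i _; rewrite mulrC. Qed.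

Fact dot_is_linear (R : realType) m (x : 'rV[R]_m) :
  linear (dot x : 'rV[R]_m -> R^o).
Proof.
move=> c y z; rewrite /dot /GRing.scale /= mulr_sumr -big_split /=.
by apply: eq_bigr => i _; rewrite !mxE; ring.
Qed.

HB.instance Definition _ (R : realType) m (x : 'rV[R]_m) :=
  GRing.isLinear.Build R 'rV[R]_m R^o *:%R (dot x) (dot_is_linear x).

Lemma dotBr (R : realType) m (x y z : 'rV[R]_m) :
  dot x (y - z) = dot x y - dot x z.
Proof. exact: (linearB (dot x)). Qed.

Lemma dotDr (R : realType) m (x y z : 'rV[R]_m) :
  dot x (y + z) = dot x y + dot x z.
Proof. exact: (linearD (dot x)). Qed.

Lemma dotZr (R : realType) m (x y : 'rV[R]_m) (c : R) :
  dot x (c *: y) = c * dot x y.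
Proof. exact: (linearZ_LR (dot x)). Qed.

Lemma dot0r (R : realType) m (x : 'rV[R]_m) : dot x 0 = 0.
Proof. exact: (linear0 (dot x)). Qed.

Lemma dot_sumr (R : realType) m (I : finType) (x : 'rV[R]_m)
    (f : I -> 'rV[R]_m) : dot x (\sum_i f i) = \sum_i dot x (f i).
Proof. exact: (linear_sum (dot x)). Qed.

Lemma dotBl (R : realType) m (x y z : 'rV[R]_m) :
  dot (x - y) z = dot x z - dot y z.
Proof. by rewrite dotC dotBr !(dotC z). Qed.

Lemma dot_realvec (R : realType) m (x y : 'rV[int]_m) :
  dot (realvec x : 'rV[R]_m) (realvec y) = (\sum_(i < m) x 0 i * y 0 i)%:~R.
Proof. by rewrite rmorph_sum; apply: eq_bigr => i _; rewrite !mxE rmorphM. Qed.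

Lemma norm2_le_coord (R : realType) m (x : 'rV[R]_m) (c : R) :
  0 <= c -> (forall j, `|x 0 j| <= c) -> norm2 x <= Num.sqrt m%:R * c.
Proof.
move=> c0 xc; rewrite -[X in _ * X](ger0_norm c0) -sqrtr_sqr -sqrtrM//.
rewrite ler_wsqrtr// /dot.
apply: (@le_trans _ _ (\sum_(i < m) c ^+ 2)).
  apply: ler_sum => i _; rewrite -expr2 -[leLHS]real_normK ?num_real//.
  by rewrite lerXn2r ?nnegrE.
by rewrite sumr_const card_ord mulr_natl.
Qed.

(** * Normal cones of polyhedra *)

(** Farkas' lemma is applied to the constraints tight at [x0]. Its alternative is a direction [z] in
    [H] along which a short step from [x0] stays feasible and increases [dot y], against
    maximality. *)
Lemma normal_cone_generators (R : realType) m k (a : 'I_k -> 'rV[R]_m)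
    (b : 'I_k -> R) (H : {vspace 'rV[R]_m}) (x0 y : 'rV[R]_m) :
  x0 \in H -> (forall i, dot (a i) x0 <= b i) ->
  (forall x, x \in H -> (forall i, dot (a i) x <= b i) ->
    dot y x <= dot y x0) ->
  exists beta : 'I_k -> R,
    [/\ forall i, 0 <= beta i,
        forall i, beta i != 0 -> dot (a i) x0 = b i,
        (#|[pred i | beta i != 0%R]| <= m)%N
      & {in H, forall x, dot y x = \sum_(i < k) beta i * dot (a i) x}].
Proof.
move=> x0H ax0 y_max.
pose tight i := dot (a i) x0 == b i.
(* A slack constraint becomes the zero functional, which keeps the index type ['I_k]; its
   coefficient is later reset to 0. *)
pose f i : 'Hom('rV[R]_m, R^o) := 
    linfun (dot (if tight i then a i else 0) : 'rV[R]_m -> R^o).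
have [[beta [beta0 card_beta yE]]|[z [zH fz yz]]] :=
    farkas_caratheodory f (linfun (dot y : 'rV[R]_m -> R^o)) H.
  exists (fun i => if tight i then beta i else 0); split.
  - by move=> i; case: ifP.
  - by move=> i; case: ifP => [/eqP//|]; rewrite eqxx.
  - apply: (@leq_trans #|[pred i | beta i != 0%R]|).
      apply: subset_leq_card; apply/fintype.subsetP => i; rewrite !inE.
      by case: ifP; rewrite ?eqxx.
    rewrite (leq_trans card_beta)// (leq_trans (dimvS (subvf H)))//.
    by rewrite dimvf /dim /= mul1n.
  - move=> x xH; have := yE x xH; rewrite lfunE /= => ->.
    apply: eq_bigr => i _; rewrite lfunE /=.
    by case: ifP; rewrite ?mul0r// dotC dot0r mulr0.
exfalso.
have slack i : ~~ tight i -> 0 < b i - dot (a i) x0.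
  by move=> nt; rewrite subr_gt0 lt_neqAle nt ax0.
(* Each summand is a ratio of growth along [z] to available slack, so a step of length [(1 + S)^-1]
   violates no slack constraint. *)
pose S := \sum_(i | ~~ tight i) `|dot (a i) z| / (b i - dot (a i) x0).
have S0 : 0 <= S.
  by apply: sumr_ge0 => i nt; rewrite divr_ge0// ltW// slack.
have t0 : 0 < (1 + S)^-1 by rewrite invr_gt0 ltr_wpDr.
have : dot y (x0 + (1 + S)^-1 *: z) <= dot y x0.
  apply: y_max => [|i]; first by rewrite rpredD ?rpredZ.
  rewrite dotDr dotZr; have := fz i; rewrite lfunE /=.
  case: ifPn => [_ az|nt _].
    have := ax0 i; have : (1 + S)^-1 * dot (a i) z <= 0.
      by rewrite mulr_ge0_le0// ltW.
    lra.
  rewrite -lerBrDl mulrC ler_pdivrMr ?ltr_wpDr//.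
  rewrite -ler_pdivrMl ?slack// mulrC.
  apply: (@le_trans _ _ (`|dot (a i) z| / (b i - dot (a i) x0))).
    by rewrite ler_wpM2r ?ler_norm// invr_ge0 ltW// slack.
  rewrite /S (bigD1 i)//=.
  set T := (X in _ + (_ + X)).
  have : 0 <= T.
    by apply: sumr_ge0 => j /andP[nj _]; rewrite divr_ge0// ltW// slack.
  lra.
rewrite dotDr dotZr gerDl.
by move: yz; rewrite lfunE /= => yz; rewrite leNgt mulr_gt0.
Qed.

(** * Convex hulls of finite sets of integer points *)

Lemma dot_conv_hull_le (R : realType) m (F : {fset 'rV[int]_m})
    (y x : 'rV[R]_m) (c : R) :
  conv_hull F x -> (forall a : F, dot y (realvec (val a)) <= c) -> dot y x <= c.
Proof.
move=> [w [w0 w1 ->]] yc; rewrite dot_sumr -[c]mul1r -w1 mulr_suml.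
by apply: ler_sum => a _; rewrite dotZr ler_wpM2l.
Qed.

Lemma conv_hull_vertex (R : realType) m (F : {fset 'rV[int]_m}) (a : F) :
  conv_hull F (realvec (val a) : 'rV[R]_m).
Proof.
exists (fun a' => (a' == a)%:R); split.
- by move=> a'; rewrite ler0n.
- by rewrite (bigD1 a)//= eqxx big1 ?addr0// => i /negbTE ->.
- rewrite (bigD1 a)//= eqxx scale1r big1 ?addr0// => i /negbTE ->.
  by rewrite scale0r.
Qed.

Lemma conv_hull_inhabited (R : realType) m (F : {fset 'rV[int]_m})
    (x : 'rV[R]_m) :
  conv_hull F x -> inhabited F.
Proof.
move=> [w [_ w1 _]]; apply: contrapT => nF.
have : \sum_(a : F) w a = 0 by rewrite big1// => a _; case: nF; exists.
by rewrite w1 => /eqP; rewrite oner_eq0.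
Qed.

Lemma exists_maximizing_vertex (R : realType) m (F : {fset 'rV[int]_m})
    (y theta : 'rV[R]_m) : conv_hull F theta ->
  exists a0 : F, forall x, conv_hull F x -> dot y x <= dot y (realvec (val a0)).
Proof.
move=> /conv_hull_inhabited[a1].
case: (@arg_maxP _ _ _ a1 xpredT (fun a : F => dot y (realvec (val a)))) => //.
move=> a0 _ a0_max; exists a0 => x xF.
by apply: (dot_conv_hull_le xF) => a; apply: a0_max.
Qed.

(** * Bounds on [hfun] and [gfun] by the bit complexity *)

Section BitComplexity.
Context {R : realType} {m : nat} {F : {fset 'rV[int]_m}} (p : F -> R).
Hypothesis p0 : forall a, 0 < p a.

Lemma bit_complexity_ge a : `|ln (p a)| <= bit_complexity p.
Proof. exact: (le_bigmax 0 (fun a => `|ln (p a)|)). Qed.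

Lemma bit_complexity_ge0 : 0 <= bit_complexity p.
Proof. exact: bigmax_ge_id. Qed.

Lemma weight_le a : p a <= expR (bit_complexity p).
Proof.
rewrite -[p a]lnK ?posrE// ler_expR.
by rewrite (le_trans (ler_norm _))// bit_complexity_ge.
Qed.

Lemma weight_ge a : expR (- bit_complexity p) <= p a.
Proof.
rewrite -[p a]lnK ?posrE// ler_expR lerNl.
by rewrite (le_trans (ler_norm _))// normrN bit_complexity_ge.
Qed.

Lemma sum_weight_le :
  \sum_(a : F) p a <= (#|` F|%fset)%:R * expR (bit_complexity p).
Proof.
apply: (@le_trans _ _ (\sum_(a : F) expR (bit_complexity p))).
  by apply: ler_sum => a _; apply: weight_le.
by rewrite sumr_const -cardfE mulr_natl.
Qed.

(** A point of [F] maximizing [dot y] has a nonnegative exponent, so its term alone is at least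
    [expR (- bit_complexity p)]. *)
Lemma hfun_ge theta y : conv_hull F theta -> - bit_complexity p <= hfun p theta y.
Proof.
move=> thetaF; have [a0 a0_max] := exists_maximizing_vertex y thetaF.
have h0 : 0 <= dot (realvec (val a0) - theta) y.
  by rewrite dotC dotBr subr_ge0 a0_max.
rewrite -[leLHS]expRK /hfun ler_ln ?posrE ?expR_gt0//; last first.
  rewrite (bigD1 a0)//= ltr_pwDl ?mulr_gt0 ?expR_gt0// sumr_ge0// => a _.
  by rewrite mulr_ge0 ?expR_ge0 ?ltW.
rewrite (bigD1 a0)//= ler_wpDr//.
  by apply: sumr_ge0 => a _; rewrite mulr_ge0 ?expR_ge0 ?ltW.
rewrite (le_trans (weight_ge a0))// ler_peMr ?(ltW (p0 a0))//.
by rewrite -expR0 ler_expR.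
Qed.

Lemma hfun0_le theta : conv_hull F theta ->
  hfun p theta 0 <= bit_complexity p + ln (#|` F|%fset)%:R.
Proof.
move=> /conv_hull_inhabited[a].
have F0 : 0 < (#|` F|%fset)%:R :> R.
  by rewrite ltr0n cardfE; apply/card_gt0P; exists a.
rewrite -[X in X + _]expRK -lnM ?posrE ?expR_gt0// /hfun.
under eq_bigr do rewrite dot0r expR0 mulr1.
have S0 : 0 < \sum_(a : F) p a.
  by rewrite (bigD1 a)//= ltr_pwDl// sumr_ge0// => i _; rewrite ltW.
by rewrite ler_ln ?posrE ?mulr_gt0 ?expR_gt0// mulrC sum_weight_le.
Qed.

Lemma gfun_ge theta : conv_hull F theta ->
  ((- bit_complexity p)%:E <= gfun p theta)%E.
Proof.
move=> thetaF; apply: le_ereal_inf_tmp => _ [y _ <-].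
by rewrite lee_fin hfun_ge.
Qed.

(** Finiteness of the infimum is what permits the choice of a near-minimizer. *)
Lemma gfun_fin_num theta : conv_hull F theta -> gfun p theta \is a fin_num.
Proof.
move=> thetaF; rewrite fin_numE; apply/andP; split.
  apply/eqP => g_ninfty; have := gfun_ge thetaF.
  by rewrite g_ninfty leeNy_eq.
apply/eqP => g_pinfty.
have : (gfun p theta <= (hfun p theta 0)%:E)%E.
  by apply: ereal_inf_lbound; exists 0.
by rewrite g_pinfty leye_eq.
Qed.

End BitComplexity.

(** * Truncation of normal cone coefficients *)

Lemma truncation (R : realType) m (F : {fset 'rV[int]_m}) (M : nat)
    (y theta : 'rV[R]_m) (D : R) :
  facet_bounded (conv_hull F : set 'rV[R]_m) M -> conv_hull F theta -> 0 <= D ->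
  exists (a0 : F) (y' : 'rV[R]_m),
    [/\ norm2 y' <= m%:R `^ (3 / 2) * M%:R * D,
        dot (realvec (val a0) - theta) y' <= dot (realvec (val a0) - theta) y
      & forall a : F,
        dot (realvec (val a) - realvec (val a0)) y' =
          dot (realvec (val a) - realvec (val a0)) y \/
        dot (realvec (val a) - realvec (val a0)) y' <= - D].
Proof.
move=> [k [a [b [H [aM PE]]]]] thetaF D0.
have inP x : conv_hull F x ->
    (forall i, dot (realvec (a i)) x <= b i) /\ x \in H.
  by move=> xF; have : conv_hull F x := xF; rewrite PE => -[].
have [a0 a0_max] := exists_maximizing_vertex y thetaF.
set x0 := realvec (val a0) in a0_max *.
have x0F : conv_hull F x0 by exact: conv_hull_vertex.
have [ax0 x0H] := inP _ x0F.
have [|beta [beta0 tight card_beta yE]] :=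
    normal_cone_generators x0H ax0 (y := y).
  by move=> x xH ax; apply: a0_max; rewrite PE; split.
pose y' := \sum_(i < k) Num.min (beta i) D *: realvec (a i) : 'rV[R]_m.
have min0 i : 0 <= Num.min (beta i) D by rewrite le_min beta0.
have y'E x : dot x y' = \sum_(i < k) Num.min (beta i) D * dot (realvec (a i)) x.
  by rewrite dot_sumr; apply: eq_bigr => i _; rewrite dotZr dotC.
have slack i x : conv_hull F x -> beta i != 0 ->
    0 <= dot (realvec (a i)) (x0 - x).
  by move=> xF bi; rewrite dotBr subr_ge0 tight//; apply: (inP _ xF).1.
have diffH x : conv_hull F x -> x0 - x \in H.
  by move=> xF; rewrite rpredB//; apply: (inP _ xF).2.
exists a0, y'; split.
(* At most [m] coefficients are nonzero, each adding at most [D * M] to a coordinate; the Euclidean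
   norm costs a further factor [Num.sqrt m]. *)
- have y'_coord j : `|y' 0 j| <= m%:R * (D * M%:R).
    rewrite summxE (le_trans (ler_norm_sum _ _ _))//.
    apply: (@le_trans _ _ (\sum_(i < k | beta i != 0) D * M%:R)).
      rewrite [leRHS]big_mkcond /=; apply: ler_sum => i _.
      rewrite !mxE normrM (ger0_norm (min0 i)).
      case: eqP => [->|_]; first by rewrite min_l// mul0r.
      rewrite ler_pM//; first by rewrite ge_min lexx orbT.
      by rewrite -intr_norm -[M%:R]/(M%:Z%:~R) ler_int.
    rewrite sumr_const -[leLHS]mulr_natl ler_wpM2r ?mulr_ge0//.
    by rewrite ler_nat.
  apply: (le_trans (norm2_le_coord _ y'_coord)); first by rewrite !mulr_ge0.
  have [->|m0] := eqVneq m 0%N.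
    by rewrite sqrtr0 mul0r !mulr_ge0// powR_ge0.
  have -> : 3 / 2 = 1 + 2^-1 :> R by lra.
  rewrite powRD; last by rewrite pnatr_eq0 m0 implybT.
  rewrite powRr1// powR12_sqrt//.
  by rewrite le_eqVlt; apply/orP; left; apply/eqP; ring.
- rewrite dotC [leRHS]dotC [leLHS]dotC y'E yE ?diffH//.
  apply: ler_sum => i _.
  have [->|bi] := eqVneq (beta i) 0; first by rewrite min_l// !mul0r.
  by rewrite ler_wpM2r ?slack// ge_min lexx.
- move=> a1; set x1 := realvec (val a1).
  have x1F : conv_hull F x1 by exact: conv_hull_vertex.
  rewrite -opprB -scaleN1r !(dotC (_ *: _)) !dotZr !mulN1r !(dotC _ (x0 - x1)).
  rewrite (dotC _ y) y'E yE ?diffH//.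
  (* If a coefficient that gets cut has a nonzero pairing, its term alone reaches [D] and the others
     are nonnegative. Otherwise no term changes. *)
  have [[i /andP[Dbi si]]|none] := pselect (exists i,
      (D < beta i) && (dot (realvec (a i)) (x0 - x1) != 0)); last first.
    left; congr (- _); apply: eq_bigr => i _.
    have [bD|Db] := leP (beta i) D => //.
    have [->|si] := eqVneq (dot (realvec (a i)) (x0 - x1)) 0.
      by rewrite !mulr0.
    by case: none; exists i; rewrite Db.
  right; rewrite lerN2.
  have bi : beta i != 0 by rewrite gt_eqF// (le_lt_trans D0).
  have si1 : 1 <= dot (realvec (a i)) (x0 - x1).
    move: (slack i x1 x1F bi) si; rewrite dotBr !dot_realvec -rmorphB /=.
    rewrite ler0z intr_eq0 -[1]/(1%:~R) ler_int => s0 sn0.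
    by rewrite -gtz0_ge1 lt_neqAle eq_sym sn0.
  rewrite (bigD1 i)//= ler_wpDr//; last first.
    by rewrite min_r ?(ltW Dbi)// ler_peMr.
  apply: sumr_ge0 => j _.
  have [->|bj] := eqVneq (beta j) 0; first by rewrite min_l// mul0r.
  by rewrite mulr_ge0// slack.
Qed.

(** With [A] the exponent of [a0] at [y], truncation adds at most [|F| exp(L + A - D)] to the sum,
    which is at least [exp(A - L)]. The relative error is thus at most [eta], and
    [1 + eta <= expR eta] makes it additive after the logarithm. *)
Lemma hfun_truncation (R : realType) m (F : {fset 'rV[int]_m}) (M : nat)
    (p : F -> R) (y theta : 'rV[R]_m) (D : R) : (forall a, 0 < p a) ->
  facet_bounded (conv_hull F : set 'rV[R]_m) M -> conv_hull F theta -> 0 <= D ->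
  exists y' : 'rV[R]_m,
    norm2 y' <= m%:R `^ (3 / 2) * M%:R * D /\
    hfun p theta y' <= hfun p theta y +
      (#|` F|%fset)%:R * expR (2 * bit_complexity p - D).
Proof.
move=> p0 FM thetaF D0.
have [a0 [y' [y'_norm y'_le y'_trunc]]] := truncation y FM thetaF D0.
exists y'; split => //.
set L := bit_complexity p; set eta := _ * expR _.
have dotE (z : 'rV[R]_m) (a : F) : dot (realvec (val a) - theta) z =
    dot (realvec (val a0) - theta) z + dot (realvec (val a) - realvec (val a0)) z.
  by rewrite !dotBl; ring.
have S0 (z : 'rV[R]_m) :
    0 < \sum_(a : F) p a * expR (dot (realvec (val a) - theta) z).
  rewrite (bigD1 a0)//= ltr_pwDl ?mulr_gt0 ?expR_gt0// sumr_ge0// => a _.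
  by rewrite mulr_ge0 ?expR_ge0 ?ltW.
rewrite -[X in _ + X]expRK /hfun -lnM ?posrE ?expR_gt0//.
rewrite ler_ln ?posrE ?mulr_gt0 ?expR_gt0//.
set A := dot (realvec (val a0) - theta) y.
apply: (@le_trans _ _ (\sum_(a : F) (p a * expR (dot (realvec (val a) - theta) y)
    + p a * (expR A * expR (- D))))).
  apply: ler_sum => a _; rewrite -mulrDr ler_wpM2l ?(ltW (p0 a))//.
  rewrite (dotE y') (dotE y) -/A !expRD -mulrDr ler_pM ?expR_ge0 ?ler_expR//.
  have [->|trunc] := y'_trunc a; first by rewrite lerDl expR_ge0.
  by rewrite ler_wpDl ?expR_ge0// ler_expR.
set S := \sum_(a : F) p a * _.
have S_ge : expR A * expR (- L) <= S.
  rewrite /S (bigD1 a0)//= ler_wpDr//.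
    by apply: sumr_ge0 => a _; rewrite mulr_ge0 ?expR_ge0 ?ltW.
  by rewrite mulrC ler_wpM2r ?expR_ge0// weight_ge.
rewrite big_split /= -mulr_suml.
apply: (@le_trans _ _ (S * (1 + eta))); last first.
  by rewrite ler_wpM2l ?expR_ge1Dx// ltW// S0.
rewrite mulrDr mulr1 lerD2l.
have eta0 : 0 <= eta by rewrite mulr_ge0 ?expR_ge0.
apply: le_trans (ler_wpM2r eta0 S_ge).
have -> : eta = (#|` F|%fset)%:R * expR L * (expR L * expR (- D)).
  by rewrite /eta -mulrA -!expRD; congr (_ * expR _); ring.
have -> : expR A * expR (- L) * ((#|` F|%fset)%:R * expR L * (expR L * expR (- D)))
    = (#|` F|%fset)%:R * expR L * (expR A * expR (- D)) * (expR L * expR (- L)).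
  by ring.
rewrite -[expR L * _]expRD addrN expR0 mulr1.
by rewrite ler_wpM2r ?mulr_ge0 ?expR_ge0// sum_weight_le.
Qed.

(** * Numerical estimate, degenerate cases and conclusion *)

(** For [c = 12/5 <= e], add [ln (x / c) <= x / c - 1] and [ln c <= 1]. The slope must be below 1/2
    for a multiple of [L] to be left over when [2 * L + l] bounds [eps]. *)
Lemma ln_le_fraction (R : realType) (x : R) : 0 < x -> ln x <= 5 / 12 * x.
Proof.
move=> x0.
have e_ge : (12 / 5 : R) <= expR 1.
  have -> : (1 : R) = 4%:R * 4^-1 by rewrite divff.
  rewrite expRM_natl; apply: (@le_trans _ _ ((5 / 4) ^+ 4)).
    by rewrite !exprS expr0; lra.
  have := expR_ge1Dx (4^-1 : R).
  by move=> h; rewrite lerXn2r ?nnegrE ?expR_ge0//; lra.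
have : ln (x / (12 / 5)) <= x / (12 / 5) - 1.
  have h : 0 < x / (12 / 5) by lra.
  have := @le_ln1Dx _ (x / (12 / 5) - 1).
  rewrite addrCA subrr addr0; apply; lra.
have c0 : (0 : R) < 12 / 5 by lra.
rewrite lnM ?posrE ?invr_gt0// lnV ?posrE//.
have : ln (12 / 5 : R) <= 1.
  by rewrite -[leRHS](@expRK R) ler_ln ?posrE ?expR_gt0//; lra.
lra.
Qed.

Lemma conv_hull_card1 (R : realType) m (F : {fset 'rV[int]_m})
    (theta : 'rV[R]_m) (a : F) : (#|` F|%fset <= 1)%N -> conv_hull F theta ->
  theta = realvec (val a).
Proof.
rewrite cardfE => /card_le1P F1 [w [_ w1 ->]].
rewrite -[RHS]scale1r -w1 scaler_suml; apply: eq_bigr => a' _.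
by have /eqP -> : a' == a by have := F1 a isT a'; rewrite inE.
Qed.

(** Dimension 0 has a single vector. This makes [ln m] nonnegative in the final estimate. *)
Lemma fset_rV_dim_gt0 m (F : {fset 'rV[int]_m}) :
  (1 < #|` F|%fset)%N -> (0 < m)%N.
Proof.
case: m F => // F; rewrite ltnNge cardfE => /negP[]; apply/card_le1P => a _ a'.
rewrite !inE; apply/esym/eqP/val_inj.
by rewrite (thinmx0 (val a)) (thinmx0 (val a')).
Qed.

(* r is negative when eps is very large; the ball of radius r centered at 0 is
   then understood as the origin, whence the maximum below. *)
Theorem theorem4p2 (R : realType) :
  exists C : R, 0 < C /\
  forall (m : nat) (F : {fset 'rV[int]_m}) (M : nat),
    is_unary_facet_complexity (conv_hull F : set 'rV[R]_m) M ->
  forall p : F -> R, (forall a, 0 < p a) ->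
  forall eps : R, 0 < eps ->
  let r := C * (m%:R `^ (3 / 2)) * M%:R *
           (bit_complexity p + ln (#|` F|%fset)%:R + ln (m%:R / eps)) in
  forall theta : 'rV[R]_m, conv_hull F theta ->
  exists y : 'rV[R]_m,
    norm2 y <= Num.max 0 r /\
    ((hfun p theta y)%:E <= gfun p theta + eps%:E)%E.
Proof.
exists 10; split=> // m F M [FM _] p p0 eps eps0 /=.
set L := bit_complexity p; set l := ln (#|` F|%fset)%:R.
set r := (X in Num.max 0 X); move=> theta thetaF.
have norm0 : norm2 (0 : 'rV[R]_m) <= Num.max 0 r.
  by rewrite /norm2 dot0r sqrtr0 le_max lexx.
have [a0] := conv_hull_inhabited thetaF.
have [F1|F2] := leqP (#|` F|%fset) 1.
  exists 0; split => //.
  apply: (@le_trans _ _ (gfun p theta)); last by rewrite leeDl// lee_fin ltW.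
  apply: le_ereal_inf_tmp => _ [y _ <-].
  have hE (z : 'rV[R]_m) : hfun p theta z = ln (\sum_(a : F) p a).
    congr ln; apply: eq_bigr => a _.
    by rewrite (conv_hull_card1 a F1 thetaF) subrr dotC dot0r expR0 mulr1.
  by rewrite !hE.
(* The threshold is the gap between [hfun p theta 0 <= L + l] and [gfun p theta >= - L]. *)
have [eps_large|eps_small] := leP (2 * L + l) eps.
  exists 0; split => //.
  apply: (@le_trans _ _ ((- L)%:E + eps%:E)%E); last first.
    by rewrite leeD2r// gfun_ge.
  rewrite -EFinD lee_fin (le_trans (hfun0_le p0 thetaF))//.
  by rewrite -/L -/l; lra.
have gfin := gfun_fin_num p0 thetaF.
have [|_ [y _ <-] hy] := @lb_ereal_inf_adherent _ _ (eps / 2) _ gfin.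
  by rewrite divr_gt0.
(* The maximum with 0 makes [D] an admissible truncation level when the logarithmic factor of [r] is
   negative. *)
pose D : R := Num.max 0 (10 * (L + l + ln (m%:R / eps))).
have D0 : 0 <= D by rewrite le_max lexx.
have [y' [y'_norm hy']] := hfun_truncation y p0 FM thetaF D0.
exists y'; split.
  rewrite (le_trans y'_norm)// /D maxr_pMr ?mulr0; last first.
    by rewrite mulr_ge0// powR_ge0.
  by rewrite [X in Num.max 0 X <= _](_ : _ = r)// /r; ring.
have L0 : 0 <= L by exact: bit_complexity_ge0.
have lnl : ln 2 <= l.
  by rewrite /l ler_ln ?posrE ?ltr0n ?ler_nat// (ltn_trans _ F2).
have F0 : 0 < (#|` F|%fset)%:R :> R by rewrite ltr0n (ltn_trans _ F2).
have DE : 2 * L + l + (ln 2 - ln eps) <= D.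
  have ln_eps : ln eps <= 5 / 12 * (2 * L + l).
    apply: le_trans (ln_le_fraction eps0) _.
    by rewrite ler_wpM2l// ltW.
  have m0 : 1 <= m%:R :> R by rewrite ler1n (fset_rV_dim_gt0 F2).
  have m_gt0 : 0 < m%:R :> R by exact: lt_le_trans ltr01 m0.
  have -> : D = Num.max 0 (10 * (L + l + (ln m%:R - ln eps))).
    by rewrite /D lnM ?posrE ?invr_gt0// lnV ?posrE.
  rewrite le_max; apply/orP; right.
  have lnm := ln_ge0 m0; have ln2 : 0 <= ln 2 :> R by rewrite ln_ge0// ler1n.
  (* It remains to see [9 ln eps <= 8 L + 9 l - ln 2 + 10 ln m]. The left side is at most
     [(15/2) L + (15/4) l], and [ln 2 <= l] pays for [ln 2]. *)
  lra.
have err : (#|` F|%fset)%:R * expR (2 * L - D) <= eps / 2.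
  rewrite -[X in X * _]lnK ?posrE// -/l -expRD.
  rewrite -[leRHS]lnK ?posrE ?divr_gt0// ler_expR.
  rewrite lnM ?posrE ?invr_gt0// lnV ?posrE//.
  lra.
apply: (@le_trans _ _ ((hfun p theta y)%:E + (eps / 2)%:E)%E).
  by rewrite -EFinD lee_fin (le_trans hy')// lerD2l.
rewrite [X in (_ <= _ + X)%E](_ : _ = (eps / 2)%:E + (eps / 2)%:E)%E; last first.
  by rewrite -EFinD -splitr.
by rewrite addeA leeD2r// ltW.
Qed.
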